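(* Let $\mathcal D$ be a sequence (set) of positive integers and let $0<\theta<1/6$. Then for any $\varepsilon>0$, almost surely, as $N\to\infty$, $$\sum_{n=1}^N d_{\theta,\mathcal D}(B_n) = M_{\theta,\mathcal D}(N)+\mathcal O_\varepsilon\big(M_{\theta,\mathcal D}(N)^{1/2+\varepsilon}\big).$$
   Context: $(\beta_i)_{i\ge1}$ is a sequence of independent Bernoulli random variables with $\mathbf P\{\beta_i=0\}=\mathbf P\{\beta_i=1\}=1/2$, and $B_n=\beta_1+\dots+\beta_n$. For $\theta>0$ and a set $\mathcal D$ of positive integers, $$d_{\theta,\mathcal D}(B_n)=\sum_{d\in\mathcal D,\ d\le n^\theta}\mathbf 1_{\{d\mid B_n\}},\qquad M_{\theta,\mathcal D}(N)=\sum_{n=1}^N\mathbf E\, d_{\theta,\mathcal D}(B_n)=\sum_{n\le N}\ \sum_{d\in\mathcal D,\ d\le n^\theta}\mathbf P\{d\mid B_n\}.$$ (Every $d$ divides $0$.) The implied constant in an almost sure $\mathcal O_\varepsilon$ statement may depend on $\varepsilon$ and on the sample point. *)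

(* Defs.v *)
From HB Require Import structures.
From mathcomp Require Import all_boot all_order all_algebra.
From mathcomp Require Import finmap.
From mathcomp Require Import all_classical all_reals all_analysis.
Import Order.TTheory GRing.Theory Num.Theory.
Import numFieldNormedType.Exports.

Set Implicit Arguments.
Unset Strict Implicit.
Unset Printing Implicit Defensive.

Local Open Scope classical_set_scope.
Local Open Scope ring_scope.

Definition mutually_independent d (T : measurableType d) (R : realType)
    (P : probability T R) d' (S : measurableType d') (I : choiceType)
    (X : I -> {RV P >-> S}) : Prop :=
  forall (J : {fset I}) (A : I -> set S), (forall i, measurable (A i)) ->
    (P (\bigcap_(i in [set` J]) (X i @^-1` A i)) =
     \prod_(i <- J) P (X i @^-1` A i))%E.

(* A nat-valued variable with P{X = 0} = P{X = 1} = 1/2; it may take other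
   values, but only on a null set. *)
Definition fair_bernoulli d (T : measurableType d) (R : realType)
    (P : probability T R) (X : {RV P >-> nat}) : Prop :=
  P (X @^-1` [set 0%N]) = (2^-1 : R)%:E /\
  P (X @^-1` [set 1%N]) = (2^-1 : R)%:E.

(* [beta i] is the variable written beta_(i+1) in the usual 1-based indexing,
   so that [Bsum beta n] is beta_1 + ... + beta_n. *)
Definition Bsum d (T : measurableType d) (R : realType) (P : probability T R)
    (beta : nat -> {RV P >-> nat}) (n : nat) (w : T) : nat :=
  (\sum_(i < n) beta i w)%N.

(* For a natural number d, d <= n^theta iff d <= truncn (n^theta). *)
Definition div_count (R : realType) (theta : R) (D : set nat) (n b : nat) : nat :=
  (\sum_(0 <= d < (Num.truncn (n%:R `^ theta)).+1 | d \in D) (d %| b))%N.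

(* [fine] loses nothing: the expectation of the bounded count is finite. *)
Definition mean_div_sum d (T : measurableType d) (R : realType)
    (P : probability T R) (beta : nat -> {RV P >-> nat})
    (theta : R) (D : set nat) (N : nat) : R :=
  \sum_(1 <= n < N.+1)
    fine ('E_P[fun w => (div_count theta D n (Bsum beta n w))%:R])%E.

(* Main.v *)
Require Import Defs.
From HB Require Import structures.
From mathcomp Require Import all_boot all_order all_algebra.
From mathcomp Require Import finmap.
From mathcomp Require Import all_classical all_reals all_analysis.
From mathcomp Require Import measurable_realfun.
From mathcomp Require Import zify ring lra.
Import Order.TTheory GRing.Theory Num.Theory.
Import numFieldNormedType.Exports.

Local Open Scope classical_set_scope.
Local Open Scope ring_scope.

(* Since [B_n] has steps 0 and 1, the function [h_d(b) = 2 (ceil(b/d) - b/d)]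
   takes values in [0, 2) and satisfies the exact identity
     1_{d | B_n} - 1/d =
       h_d(B_{n+1}) - h_d(B_n) - (2 beta_{n+1} - 1) (1_{d | B_n} - 1/d).
   Summing over [d] in [D] with [d <= n^theta] and over [n <= N], the first part
   telescopes up to an error [O(N^theta)], and the second is a martingale [W_N]
   with increments [(2 beta_{n+1} - 1) sum_d (1_{d | B_n} - 1/d)].  Taking expectations gives
   [M(N) = sum_{n <= N} sum_d 1/d + O(N^theta)], so the quantity to bound is
   [|W_{N+1}| + O(N^theta)].
   The walk spends mean time at most 2 at each site, hence the variance of [W_N]
   is at most twice [sum_{b < N} (d(b)^2 + log^2 N) = O(N log^3 N)], where [d(b)]
   counts the divisors up to [N^theta]; this only uses [theta <= 1/2].  Kolmogorov's
   maximal inequality and Borel-Cantelli along [N = 2^k] give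
   [W_N = O(N^(1/2 + eps))] almost surely, and [M(N)] grows at least linearly
   unless [D] is empty. *)

(** * Second moment of truncated divisor counts *)

Section Divisors.
Context {R : realFieldType}.

Definition harmonic_sum (K : nat) : R := \sum_(1 <= k < K.+1) k%:R^-1.

Definition divisor_count (K b : nat) : R := \sum_(1 <= k < K.+1) (k %| b)%N%:R.

Lemma harmonic_sum_ge0 K : 0 <= harmonic_sum K.
Proof. by apply: sumr_ge0 => k _; rewrite invr_ge0. Qed.

Lemma harmonic_sumS K : harmonic_sum K.+1 = harmonic_sum K + K.+1%:R^-1.
Proof. by rewrite /harmonic_sum big_nat_recr. Qed.

Lemma harmonic_sum_le K L : (K <= L)%N -> harmonic_sum K <= harmonic_sum L.
Proof.
move=> /subnK <-; elim: (L - K)%N => [|n IHn] //.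
by rewrite addSn harmonic_sumS (le_trans IHn)// lerDl invr_ge0.
Qed.

(** Each of the [2 ^ k] terms with index in [(2 ^ k, 2 ^ k.+1]] is at most [1 / 2 ^ k], so a dyadic
    block adds at most 1. *)
Lemma harmonic_sum_pow2 k : harmonic_sum (2 ^ k) <= k.+1%:R.
Proof.
elim: k => [|k IHk]; first by rewrite /harmonic_sum big_nat1 invr1.
have H n : harmonic_sum (2 ^ k + n) <= harmonic_sum (2 ^ k) + n%:R / (2 ^ k)%:R.
  elim: n => [|n IHn]; first by rewrite addn0 mul0r addr0.
  rewrite addnS harmonic_sumS [n.+1%:R]mulrSr mulrDl mul1r addrA lerD//.
  by rewrite lef_pV2 ?posrE ?ltr0n ?expn_gt0// ler_nat; lia.
have := H (2 ^ k)%N; rewrite divff ?pnatr_eq0 -?lt0n ?expn_gt0// addnn -mul2n -expnS.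
by move=> /le_trans; apply; rewrite -natr1 lerD2r.
Qed.

Lemma sum_inv_multiples (g K : nat) : (0 < g)%N ->
  \sum_(1 <= k < K.+1) (g %| k)%N%:R / k%:R = g%:R^-1 * harmonic_sum (K %/ g)%N.
Proof.
move=> g0; elim: K => [|K IHK].
  by rewrite div0n /harmonic_sum !big_geq// mulr0.
rewrite big_nat_recr//= IHK divnS//; case: (boolP (g %| K.+1))%N => gK; last first.
  by rewrite mul0r addr0.
rewrite add1n harmonic_sumS mulrDr mul1r; congr (_ + _).
have -> : K.+1 = (g * (K %/ g).+1)%N.
  by rewrite -{1}(divnK gK) divnS// gK add1n mulnC.
by rewrite natrM invfM.
Qed.

(** [1 / lcm(a, b) = gcd(a, b) / (a b)] is the term [g = gcdn a b] on the right. Summing over all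
    common divisors instead decouples [a] from [b]. *)
Lemma inv_lcm_le (K a b : nat) : (0 < a)%N -> (0 < b)%N -> (a <= K)%N ->
  (lcmn a b)%:R^-1 <=
  \sum_(1 <= g < K.+1) g%:R * ((g %| a)%N%:R / a%:R * ((g %| b)%N%:R / b%:R)) :> R.
Proof.
move=> a0 b0 aK.
have g0 : (0 < gcdn a b)%N by rewrite gcdn_gt0 a0.
rewrite (bigD1_seq (gcdn a b)) ?iota_uniq//=; last first.
  by rewrite mem_index_iota g0 ltnS (leq_trans (dvdn_leq a0 (dvdn_gcdl a b))).
rewrite dvdn_gcdl dvdn_gcdr !mul1r.
have -> : (lcmn a b)%:R^-1 = (gcdn a b)%:R * (a%:R^-1 * b%:R^-1) :> R.
  rewrite -invfM -natrM -muln_lcm_gcd natrM invfM mulrCA divff ?mulr1//.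
  by rewrite pnatr_eq0 -lt0n.
by rewrite lerDl; apply: sumr_ge0 => i _; rewrite !mulr_ge0.
Qed.

(** With [H] the harmonic sum, [inv_lcm_le] lets the double sum factor for each [g] into
    [g (H(K / g) / g) ^ 2 = H(K / g) ^ 2 / g]. Bounding [H(K / g)] by [H(K)], the sum over [g]
    supplies the third factor. *)
Lemma sum_inv_lcm_le K :
  \sum_(1 <= a < K.+1) \sum_(1 <= b < K.+1) (lcmn a b)%:R^-1
  <= harmonic_sum K ^+ 3.
Proof.
apply: (@le_trans _ _ (\sum_(1 <= g < K.+1)
    g%:R * (\sum_(1 <= k < K.+1) (g %| k)%N%:R / k%:R) ^+ 2)).
  under [leRHS]eq_bigr => g _ do
    rewrite expr2 big_distrl/= mulr_sumr; rewrite [leRHS]exchange_big/=.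
  apply: ler_sum_nat => a aK.
  under [leRHS]eq_bigr => g _ do rewrite !mulr_sumr; rewrite [leRHS]exchange_big/=.
  by apply: ler_sum_nat => b bK; apply: inv_lcm_le; lia.
rewrite exprS {1}/harmonic_sum mulr_suml; apply: ler_sum_nat => g /andP[g0 _].
rewrite sum_inv_multiples//; set x := harmonic_sum (K %/ g).
have -> : g%:R * (g%:R^-1 * x) ^+ 2 = g%:R^-1 * x ^+ 2.
  by field; rewrite pnatr_eq0 -lt0n.
rewrite ler_wpM2l ?invr_ge0// lerXn2r ?nnegrE ?harmonic_sum_ge0//.
by rewrite harmonic_sum_le// leq_div.
Qed.

(** The site 0, divisible by everything, gives [K ^ 2]. For [j >= 1] the square counts pairs
    [(a, b)] with [lcmn a b %| j], and at most [m / lcmn a b] such [j] occur. *)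
Lemma sum_divisor_count_sqr K m :
  \sum_(0 <= j < m) divisor_count K j ^+ 2
  <= K%:R ^+ 2 + m%:R * harmonic_sum K ^+ 3.
Proof.
case: m => [|m]; first by rewrite big_geq// addr_ge0 ?mul0r ?sqr_ge0.
rewrite big_nat_recl// lerD//.
  rewrite /divisor_count (eq_bigr (fun=> 1)) => [|k _]; last by rewrite dvdn0.
  by rewrite sumr_const_nat subn1.
have -> : \sum_(0 <= i < m) divisor_count K i.+1 ^+ 2 =
    \sum_(1 <= j < m.+1) divisor_count K j ^+ 2 by rewrite big_add1.
apply: (@le_trans _ _ (m.+1%:R * \sum_(1 <= a < K.+1) \sum_(1 <= b < K.+1)
    (lcmn a b)%:R^-1)); last by rewrite ler_wpM2l// sum_inv_lcm_le.
under eq_bigr => j _ do rewrite /divisor_count expr2 mulr_suml.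
rewrite exchange_big/= mulr_sumr; apply: ler_sum_nat => a aK.
under eq_bigr => j _ do rewrite mulr_sumr.
rewrite exchange_big/= mulr_sumr; apply: ler_sum_nat => b bK.
have l0 : (0 < lcmn a b)%N by rewrite lcmn_gt0; lia.
under eq_bigr => j _ do rewrite -natrM mulnb -dvdn_lcm.
rewrite -natr_sum -divn_count_dvd ler_pdivlMr ?ltr0n// -natrM ler_nat.
by rewrite (leq_trans (leq_trunc_div _ _)).
Qed.

(** The hypothesis absorbs the contribution [K ^ 2] of the site 0. The constant 3 counts that
    contribution, the cubed harmonic sum and the squared one. *)
Lemma sum_divisor_moment_le K k : (K ^ 2 <= 2 ^ k)%N ->
  \sum_(0 <= j < 2 ^ k) (divisor_count K j ^+ 2 + harmonic_sum K ^+ 2)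
  <= 3%:R * k.+1%:R ^+ 3 * (2 ^ k)%:R.
Proof.
move=> Kk; have KK : (K <= 2 ^ k)%N by rewrite (leq_trans _ Kk)//; nia.
have HK : harmonic_sum K <= k.+1%:R.
  exact: le_trans (harmonic_sum_le _ _ KK) (harmonic_sum_pow2 k).
have k1 : 1 <= k.+1%:R :> R by rewrite ler1n.
rewrite big_split/= sumr_const_nat subn0.
have := sum_divisor_count_sqr K (2 ^ k).
have : (2 ^ k)%:R * harmonic_sum K ^+ 3 <= (2 ^ k)%:R * k.+1%:R ^+ 3.
  by rewrite ler_wpM2l// lerXn2r ?nnegrE ?harmonic_sum_ge0.
have : harmonic_sum K ^+ 2 *+ (2 ^ k) <= (2 ^ k)%:R * k.+1%:R ^+ 3.
  rewrite -mulr_natl ler_wpM2l// (@le_trans _ _ (k.+1%:R ^+ 2))//.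
    by rewrite lerXn2r ?nnegrE ?harmonic_sum_ge0.
  by rewrite ler_weXn2l.
have : K%:R ^+ 2 <= (2 ^ k)%:R * k.+1%:R ^+ 3 :> R.
  apply: (@le_trans _ _ (2 ^ k)%:R); first by rewrite -natrX ler_nat.
  by rewrite ler_peMr// exprn_ege1.
lra.
Qed.

End Divisors.

(** * The walk on the binary tree *)

Section BinaryTree.
Context {R : realFieldType}.

Fixpoint bit_seqs (n : nat) : seq (seq nat) :=
  if n is n'.+1 then
    [seq 0%N :: s | s <- bit_seqs n'] ++ [seq 1%N :: s | s <- bit_seqs n']
  else [:: [::]].

(** Expectation over [n] fair bits. Recursing on the first bit makes conditioning on the first step
    a computation. *)
Fixpoint tree_mean (n : nat) (F : seq nat -> R) : R :=
  if n is n'.+1 then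
    (tree_mean n' (fun s => F (0%N :: s)) + tree_mean n' (fun s => F (1%N :: s)))
      / 2
  else F [::].

Lemma tree_meanE n F : tree_mean n F = \sum_(s <- bit_seqs n) F s / 2 ^+ n.
Proof.
elim: n F => [|n IHn] F /=; first by rewrite big_seq1 expr0 divr1.
rewrite !IHn big_cat/= !big_map mulrDl !mulr_suml exprS.
by congr (_ + _); apply: eq_bigr => s _; rewrite [2 * _]mulrC invfM mulrA.
Qed.

Lemma tree_mean_le n F G :
  (forall s, F s <= G s) -> tree_mean n F <= tree_mean n G.
Proof.
elim: n F G => [|n IHn] F G FG /=; first exact: FG.
by rewrite ler_pM2r ?invr_gt0// lerD// IHn.
Qed.

Lemma tree_mean_cst n (c : R) : tree_mean n (fun=> c) = c.
Proof. by elim: n => //= n ->; field. Qed.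

Lemma tree_meanB n F G :
  tree_mean n (fun s => F s - G s) = tree_mean n F - tree_mean n G.
Proof. by elim: n F G => //= n IHn F G; rewrite !IHn; field. Qed.

Definition walk_mean (n : nat) (g : nat -> R) : R :=
  tree_mean n (fun s => g (sumn s)).

(** [tree_mean] splits off the first bit, whereas this splits off the last; the induction therefore
    runs over an arbitrary starting site [b]. *)
Lemma walk_meanS n (g : nat -> R) :
  walk_mean n.+1 g = walk_mean n (fun b => (g b + g b.+1) / 2).
Proof.
rewrite /walk_mean.
suff H b : tree_mean n.+1 (fun s => g (b + sumn s)%N) =
    tree_mean n (fun s => (g (b + sumn s)%N + g (b + sumn s).+1) / 2).
  exact: (H 0%N).
elim: n b => [|n IHn] b; first by rewrite /= !addn0 addn1.
have E c : tree_mean n.+1 (fun s => g (b + (c + sumn s))%N) =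
    tree_mean n
      (fun s => (g (b + (c + sumn s))%N + g (b + (c + sumn s)).+1) / 2).
  under eq_fun => s do rewrite addnA.
  by rewrite IHn; under eq_fun => s do rewrite -addnA.
transitivity ((tree_mean n.+1 (fun s => g (b + (0 + sumn s))%N) +
  tree_mean n.+1 (fun s => g (b + (1 + sumn s))%N)) / 2); first by [].
by rewrite !E.
Qed.

End BinaryTree.

(** * Kolmogorov's maximal inequality on the tree *)

Section MaximalInequality.
Context {R : realFieldType} (y : nat -> nat -> R).

(* The state [(n, b, w)] is (time, current value of the walk, current value of
   the martingale). *)
Fixpoint reaches (c : R) (n b : nat) (w : R) (s : seq nat) : bool :=
  (c <= `|w|) ||
  (if s is x :: s' then reaches c n.+1 (b + x) (w + (x%:R *+ 2 - 1) * y n b) s'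
   else false).

(** Mean sum of squared increments over [m] steps of the walk from site [b] at time [n]. The
    martingale increments being orthogonal, this is the variance of their sum. *)
Fixpoint quadratic_variation (m n b : nat) : R :=
  if m is m'.+1 then
    y n b ^+ 2 + (quadratic_variation m' n.+1 b + quadratic_variation m' n.+1 b.+1) / 2
  else 0.

Lemma quadratic_variation_ge0 m n b : 0 <= quadratic_variation m n b.
Proof.
elim: m n b => [|m IHm] n b //=.
by rewrite addr_ge0 ?sqr_ge0// divr_ge0// addr_ge0.
Qed.

(** Induction on the remaining time. If [c <= |w|] already, [w ^ 2] alone pays for the event.
    Otherwise the next values [w - y] and [w + y] have mean square [w ^ 2 + y ^ 2], and [y ^ 2] is
    the term that [quadratic_variation] releases. *)
Lemma maximal_inequality (c : R) m n b w : 0 <= c ->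
  tree_mean m (fun s => (reaches c n b w s)%:R) * c ^+ 2
  <= w ^+ 2 + quadratic_variation m n b.
Proof.
move=> c0; elim: m n b w => [|m IHm] n b w.
  rewrite /= orbF addr0; case: (boolP (c <= `|w|)) => cw; last first.
    by rewrite mul0r sqr_ge0.
  by rewrite mul1r -[w ^+ 2]real_normK ?num_real// lerXn2r ?nnegrE.
have [cw|cw] := boolP (c <= `|w|).
  apply: (@le_trans _ _ (c ^+ 2)).
    rewrite ler_piMl ?sqr_ge0// -{2}(tree_mean_cst m.+1 1).
    by apply: tree_mean_le => s; case: reaches; rewrite ?ler01.
  rewrite (@le_trans _ _ (w ^+ 2))//.
    by rewrite -[w ^+ 2]real_normK ?num_real// lerXn2r ?nnegrE.
  by rewrite lerDl quadratic_variation_ge0.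
rewrite /= (negbTE cw)/= addn0 addn1.
have := IHm n.+1 b (w + (0%:R *+ 2 - 1) * y n b).
have := IHm n.+1 b.+1 (w + (1%:R *+ 2 - 1) * y n b).
set p := tree_mean _ _; set q := tree_mean _ _ => Hp Hq.
lra.
Qed.

(* The walk spends mean time at most 2 at each site. *)
Lemma quadratic_variation_le (f : nat -> R) m n b :
  (forall i j, (i < m)%N -> y (n + i) j ^+ 2 <= f j) ->
  quadratic_variation m n b <= 2 * \sum_(b <= j < b + m) f j.
Proof.
elim: m n b => [|m IHm] n b yf; first by rewrite addn0 big_geq ?mulr0.
have f0 j : 0 <= f j by apply: le_trans (yf 0%N j _); rewrite ?sqr_ge0.
have yf' i j : (i < m)%N -> y (n.+1 + i) j ^+ 2 <= f j.
  by move=> im; rewrite addSnnS yf.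
have := yf 0%N b isT; rewrite addn0 => H0.
have := IHm n.+1 b.+1 yf'; have := IHm n.+1 b yf'.
rewrite /= addSnnS; set q := quadratic_variation _ _ b.
set q' := quadratic_variation _ _ _ => H1 H2.
(* Let [S] be the sum of [f] over [[b, b + m]]. The branch that stays costs at most [2 S], the one
   that moves at most [2 (S - f b)]; their average [2 S - f b] leaves room for the current [f b]. *)
have H3 : \sum_(b <= j < b + m) f j <= \sum_(b <= j < b + m.+1) f j.
  by rewrite addnS big_nat_recr ?leq_addr//= lerDl.
have H4 : \sum_(b <= j < b + m.+1) f j = f b + \sum_(b.+1 <= j < b + m.+1) f j.
  by rewrite big_ltn// addnS ltnS leq_addr.
have := f0 b; nra.
Qed.

Definition martingale (x : nat -> nat) (N : nat) : R :=
  \sum_(0 <= i < N) ((x i)%:R *+ 2 - 1) * y i (\sum_(j < i) x j).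

Lemma martingale_reaches (c : R) (x : nat -> nat) m N : (N <= m)%N ->
  c <= `|martingale x N| -> reaches c 0 0 0 (mkseq x m).
Proof.
(* Generalized to the state after [k] steps, because [reaches] consumes the path from the front. *)
suff H k : (k <= N)%N -> (N <= k + m)%N -> c <= `|martingale x N| ->
    reaches c k (\sum_(j < k) x j) (martingale x k) [seq x i | i <- iota k m].
  move=> Nm cN; have := H 0%N (leq0n _) Nm cN.
  by rewrite big_ord0 /martingale big_geq.
elim: m k => [|m IHm] k kN Nkm cN.
  by have -> : k = N; [lia | rewrite /= cN].
rewrite /=; have [->|kN'] := eqVneq k N; first by rewrite cN.
apply/orP; right; have := IHm k.+1; rewrite big_ord_recr/= {2}/martingale.
by rewrite big_nat_recr//=; apply => //; lia.
Qed.

End MaximalInequality.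

(** * The Poisson equation and its telescoping sum *)

Section Drift.
Context {R : realFieldType} (D : pred nat) (D0 : D 0%N = false).

(** The sum starts at 0 to match [div_count]; [D0] removes that index. *)
Definition divisor_deviation (K b : nat) : R :=
  \sum_(0 <= k < K.+1 | D k) ((k %| b)%N%:R - k%:R^-1).

Definition density (K : nat) : R := \sum_(0 <= k < K.+1 | D k) k%:R^-1.

(* [corrector_term k] solves [h (b + 1) - h b = 2 (1_{k | b} - 1/k)], the
   Poisson equation of the walk; its explicit solution is
   [2 (ceil (b / k) - b / k)]. *)
Definition corrector_term (k b : nat) : R :=
  (((b + k.-1) %/ k)%N%:R - b%:R / k%:R) *+ 2.

Definition corrector (K b : nat) : R :=
  \sum_(0 <= k < K.+1 | D k) corrector_term k b.

(** The ceiling of [b / k] increases exactly when [b] steps off a multiple of [k]. *)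
Lemma corrector_termS k b : (0 < k)%N ->
  corrector_term k b.+1 = corrector_term k b + ((k %| b)%N%:R - k%:R^-1) *+ 2.
Proof.
move=> k0; rewrite /corrector_term addSn divnS//.
have -> : (k %| (b + k.-1).+1)%N = (k %| b)%N.
  by rewrite -addnS prednK// dvdn_addl.
by rewrite natrD -natr1 mulrDl mul1r -!mulrnDl; congr (_ *+ 2); ring.
Qed.

Lemma corrector_term_ge0 k b : (0 < k)%N -> 0 <= corrector_term k b.
Proof.
move=> k0; rewrite mulrn_wge0// subr_ge0 ler_pdivrMr ?ltr0n// -natrM ler_nat.
by have := divn_eq (b + k.-1) k; have := ltn_pmod (b + k.-1) k0; lia.
Qed.

Lemma corrector_term_le2 k b : (0 < k)%N -> corrector_term k b <= 2.
Proof.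
move=> k0; rewrite /corrector_term -[leRHS](mulr1 2) -mulr_natl ler_pM2l//.
rewrite lerBlDr -(ler_pM2r (x := k%:R)) ?ltr0n// mulrDl divfK ?pnatr_eq0 -?lt0n//.
rewrite mul1r -natrM -natrD ler_nat.
by have := leq_trunc_div (b + k.-1) k; lia.
Qed.

Lemma correctorS K b :
  corrector K b.+1 = corrector K b + divisor_deviation K b *+ 2.
Proof.
rewrite /corrector /divisor_deviation -sumrMnl -big_split/=.
apply: eq_bigr => -[|k]; first by rewrite D0.
by move=> _; rewrite corrector_termS.
Qed.

(** Each new modulus adds a corrector term in [[0, 2]]. This prices the growth of the cutoff with
    time. *)
Lemma corrector_mono K L b : (K <= L)%N ->
  corrector K b <= corrector L b <= corrector K b + (L%:R - K%:R) *+ 2.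
Proof.
move=> /subnK <-; elim: (L - K)%N => [|n IHn].
  by rewrite add0n subrr mul0rn addr0 lexx.
have -> : corrector (n.+1 + K) b = corrector (n + K) b +
    (if D (n + K).+1 then corrector_term (n + K).+1 b else 0).
  by rewrite /corrector addSn big_mkcond [in RHS]big_mkcond big_nat_recr.
have H0 := corrector_term_ge0 (n + K).+1 b isT.
have H2 := corrector_term_le2 (n + K).+1 b isT.
rewrite addSn -natr1; move: IHn => /andP[]; case: ifP => _; lra.
Qed.

Lemma corrector_bounds K b : 0 <= corrector K b <= K%:R *+ 2.
Proof.
have := corrector_mono 0 K b (leq0n K).
have -> : corrector 0 b = 0 by rewrite /corrector big_mkcond/= big_nat1 D0.
by rewrite add0r subr0.
Qed.

(** The deviation is a difference of two nonnegative quantities, so the cross term of its square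
    only helps. The bound depends on [L] alone and so serves all times with cutoff at most [L]. *)
Lemma divisor_deviation_sqr K L b : (K <= L)%N ->
  divisor_deviation K b ^+ 2 <= divisor_count L b ^+ 2 + harmonic_sum L ^+ 2.
Proof.
move=> KL.
have aux (F : nat -> R) : (forall k, 0 <= F k) ->
    0 <= \sum_(0 <= k < K.+1 | D k) F k <= \sum_(1 <= k < L.+1) F k.
  move=> F0; rewrite sumr_ge0//= big_mkcond big_nat_recl//= D0 add0r.
  rewrite [leRHS]big_add1/= [leRHS](big_cat_nat (n := K))//= -[leLHS]addr0 lerD//.
    by apply: ler_sum => k _; case: ifP.
  exact: sumr_ge0.
have /andP[a0 a1] := aux (fun k => (k %| b)%N%:R) (fun=> ler0n _ _).
have /andP[h0 h1] : 0 <= density K <= harmonic_sum L.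
  by apply: aux => k; rewrite invr_ge0.
rewrite /divisor_deviation big_split/= sumrN.
move: a0 a1 h0 h1; rewrite -/(density K) -/(divisor_count L b).
set a := \sum_(0 <= _ < _ | _) _; move: a (density K) => a h a0 a1 h0 h1; nra.
Qed.

End Drift.

(** Summation by parts: [b N] minus the sum equals [a 0] plus the jumps [a n.+1 - b n] for [n < N].
    These are nonnegative and telescope to at most twice [K N], so the sum is a difference of two
    numbers in [[0, 2 K N]]. *)
Lemma abel_telescope {R : realFieldType} (K : nat -> nat) (a b : nat -> R) :
  (forall n, 0 <= a n <= (K n)%:R *+ 2) -> (forall n, 0 <= b n <= (K n)%:R *+ 2) ->
  (forall n, b n <= a n.+1 <= b n + ((K n.+1)%:R - (K n)%:R) *+ 2) ->
  forall N, `|\sum_(0 <= n < N.+1) (b n - a n)| <= (K N)%:R *+ 2.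
Proof.
move=> Ha Hb Hab N.
have H : 0 <= b N - \sum_(0 <= n < N.+1) (b n - a n) <= (K N)%:R *+ 2.
  elim: N => [|N IHN]; first by rewrite big_nat1 subKr.
  by rewrite big_nat_recr//=; have := Hab N; lra.
by rewrite ler_norml; have := Hb N; lra.
Qed.

(** * From the binary tree to the probability space *)

Lemma size_bit_seqs n s : s \in bit_seqs n -> size s = n.
Proof.
elim: n s => [|n IHn] s /=; first by rewrite inE => /eqP ->.
by rewrite mem_cat => /orP[] /mapP[t /IHn <- ->].
Qed.

Lemma bit_seqs_le1 n s i : s \in bit_seqs n -> (nth 0%N s i <= 1)%N.
Proof.
elim: n s i => [|n IHn] s i /=; first by rewrite inE => /eqP ->; rewrite nth_nil.
by rewrite mem_cat => /orP[] /mapP[t /IHn + ->]; case: i => [|i] //=; apply.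
Qed.

Lemma mem_bit_seqs (x : nat -> nat) n :
  (forall i, (x i <= 1)%N) -> mkseq x n \in bit_seqs n.
Proof.
rewrite /mkseq => x1; elim: n 0%N => [|n IHn] k //=.
rewrite mem_cat; have := x1 k; case: (x k) => [|[|//]] _.
  by rewrite map_f ?IHn.
by rewrite [X in _ || X]map_f ?IHn ?orbT.
Qed.

Lemma uniq_bit_seqs n : uniq (bit_seqs n).
Proof.
elim: n => [|n IHn] //=.
rewrite cat_uniq !map_inj_uniq ?IHn//; [|by move=> s t [] |by move=> s t []].
by rewrite andbT; apply/hasPn => s /mapP[t _ ->]; apply/mapP => -[u _].
Qed.

Section BernoulliSequence.
Context {d} {T : measurableType d} {R : realType} (P : probability T R).
Context (beta : nat -> {RV P >-> nat}).
Context (beta_bernoulli : forall i, fair_bernoulli (beta i)).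
Context (beta_indep : mutually_independent beta).

Lemma ae_beta_le1 : {ae P, forall w, forall i, (beta i w <= 1)%N}.
Proof.
apply: ae_foralln => i.
have m0 : measurable (beta i @^-1` [set 0%N]) by exact: measurable_funPTI.
have m1 : measurable (beta i @^-1` [set 1%N]) by exact: measurable_funPTI.
pose A := beta i @^-1` [set 0%N] `|` beta i @^-1` [set 1%N].
have PA : P (~` A) = 0%E.
  have PA1 : P A = 1%E.
    have -> : 1%E = ((2^-1 : R)%:E + (2^-1)%:E)%E.
      by rewrite -EFinD; congr EFin; field.
    have [P0 P1] := beta_bernoulli i; rewrite -{1}P0 -P1.
    by apply: measureU => //; apply/seteqP; split => w //= [->].
  rewrite probability_setC; last exact: measurableU.
  by rewrite PA1 subee.
exists (~` A); split => //; first by apply: measurableC; exact: measurableU.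
by move=> w /= H [|] E; apply: H; rewrite E.
Qed.

Definition cylinder (n : nat) (s : seq nat) : set T :=
  [set w | mkseq (fun i => beta i w) n = s].

Lemma cylinderE n s : size s = n ->
  cylinder n s =
  \bigcap_(i in [set` seq_fset tt (iota 0 n)]) (beta i @^-1` [set nth 0%N s i]).
Proof.
have memJ i : (i \in seq_fset tt (iota 0 n)) = (i < n)%N.
  by rewrite seq_fsetE mem_iota.
move=> sn; apply/seteqP; split => w.
  move=> <- i iJ; have i_n : (i < n)%N by rewrite -memJ; exact: iJ.
  by rewrite /= nth_mkseq.
move=> H; apply: (@eq_from_nth _ 0%N); rewrite size_mkseq ?sn// => i i_n.
by rewrite nth_mkseq//; apply: H; apply: etrans i_n; exact: memJ.
Qed.

Lemma measurable_cylinder n s : measurable (cylinder n s).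
Proof.
have [sn|sn] := eqVneq (size s) n.
  rewrite cylinderE//; apply: fin_bigcap_measurable => [|i _].
    exact: finite_fset.
  exact: measurable_funPTI.
rewrite (_ : cylinder n s = set0)//; apply/seteqP; split => w //= sE.
by move: sn; rewrite -sE size_mkseq eqxx.
Qed.

Lemma probability_cylinder n s : s \in bit_seqs n ->
  P (cylinder n s) = ((2 ^+ n)^-1)%:E.
Proof.
move=> sn; rewrite cylinderE ?(size_bit_seqs _ _ sn)// beta_indep//.
rewrite (eq_bigr (fun=> ((2^-1 : R)%:E)%E)) => [|i _]; last first.
  have [] := beta_bernoulli i.
  by have := bit_seqs_le1 _ _ i sn; case: (nth _ _ _) => [|[|//]].
rewrite big_const_seq count_predT size_seq_fset undup_id ?iota_uniq// size_iota.
elim: n {s sn} => [|n IHn]; first by rewrite expr0 invr1.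
by rewrite iterS IHn -EFinM exprS invfM.
Qed.

(** A finite union of cylinders over 0-1 strings, hence measurable for any [Q]. Where all bits are
    at most 1 it is the event that [Q] holds of the first [n] bits. *)
Definition tree_event (n : nat) (Q : pred (seq nat)) : set T :=
  \big[setU/set0]_(s <- bit_seqs n | Q s) cylinder n s.

Lemma measurable_tree_event n Q : measurable (tree_event n Q).
Proof. by apply: bigsetU_measurable => s _; exact: measurable_cylinder. Qed.

Lemma mem_tree_event n (Q : pred (seq nat)) w : (forall i, beta i w <= 1)%N ->
  Q (mkseq (fun i => beta i w) n) -> tree_event n Q w.
Proof.
move=> w1 Qw; rewrite /tree_event -bigcup_seq_cond.
by exists (mkseq (fun i => beta i w) n) => //=; rewrite mem_bit_seqs// andTb.
Qed.

Lemma probability_tree_event n Q :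
  (P (tree_event n Q) <= (tree_mean n (fun s => (Q s)%:R))%:E)%E.
Proof.
rewrite tree_meanE -sumEFin.
suff H l : all (mem (bit_seqs n)) l ->
    (P (\big[setU/set0]_(s <- l | Q s) cylinder n s) <=
     \sum_(s <- l) ((Q s)%:R / 2 ^+ n)%:E)%E by apply: H; apply/allP.
elim: l => [|s l IHl] /=; first by rewrite !big_nil measure0.
move=> /andP[sn /IHl {}IHl]; rewrite !big_cons; case: ifP => Qs; last first.
  by rewrite mul0r add0e.
apply: (@le_trans _ _ (P (cylinder n s) +
    P (\big[setU/set0]_(t <- l | Q t) cylinder n t))%E).
  apply: measureU2; first exact: measurable_cylinder.
  by apply: bigsetU_measurable => t _; exact: measurable_cylinder.
by apply: leeD => //; rewrite probability_cylinder// mul1r.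
Qed.

Lemma measurable_Bsum n (A : set nat) : measurable (Bsum beta n @^-1` A).
Proof.
elim: n A => [|n IHn] A.
  rewrite (_ : _ @^-1` _ = if 0%N \in A then setT else set0); first by case: ifP.
  apply/seteqP; split => w; rewrite /= /Bsum big_ord0.
    by move=> A0; rewrite mem_set.
  by case: ifP => // /set_mem.
rewrite (_ : _ @^-1` _ = \bigcup_k
    (beta n @^-1` [set k] `&` (Bsum beta n @^-1` [set b | A (b + k)%N]))).
  apply: bigcupT_measurable => k; apply: measurableI => //.
  exact: measurable_funPTI.
apply/seteqP; split => w; rewrite /= /Bsum big_ord_recr/=.
  by move=> Aw; exists (beta n w).
by move=> [k _ [<-]].
Qed.

(** Almost surely exactly one cylinder over [bit_seqs n] contains [w], and [f (B_n)] is constant on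
    it. Integrating this finite sum of indicators gives the tree average. *)
Lemma expectation_Bsum n (f : nat -> nat) :
  ('E_P[fun w => (f (Bsum beta n w))%:R] =
   (walk_mean n (fun b => (f b)%:R : R))%:E)%E.
Proof.
rewrite unlock /walk_mean tree_meanE -sumEFin.
pose F s : T -> \bar R :=
  fun w => ((f (sumn s))%:R%:E * (\1_(cylinder n s) w)%:E)%E.
have mF s : measurable_fun setT (F s).
  apply: measurable_funeM; apply/measurable_EFinP.
  by apply: measurable_indic; exact: measurable_cylinder.
rewrite (@ge0_ae_eq_integral _ _ _ _ _ _ (fun w => \sum_(s <- bit_seqs n) F s w)%E)//.
- rewrite ge0_integral_sum//; last first.
    by move=> s w _; rewrite mule_ge0// lee_fin.
  rewrite big_seq [RHS]big_seq; apply: eq_bigr => s sn.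
  rewrite (@ge0_integralZl_EFin _ _ _ P setT measurableT
    (fun w => (\1_(cylinder n s) w)%:E))//; last first.
  + by apply/measurable_EFinP/measurable_indic; exact: measurable_cylinder.
  rewrite integral_indic//; last exact: measurable_cylinder.
  by rewrite setIT EFinM; congr (_ * _)%E; exact: probability_cylinder.
- apply/measurable_EFinP => _ A mA; rewrite setTI.
  exact: (measurable_Bsum n [set b | A (f b)%:R]).
- exact: emeasurable_sum.
- by move=> w _; apply: sume_ge0 => s _; rewrite mule_ge0// lee_fin.
- apply: filterS ae_beta_le1 => w w1 _.
  rewrite (bigD1_seq (mkseq (fun i => beta i w) n))//=; last 2 first.
  + exact: mem_bit_seqs.
  + exact: uniq_bit_seqs.
  rewrite big1 ?adde0 => [|s sw].
    rewrite /F indicE mem_set// mule1; congr (_ %:R%:E); congr f.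
    by rewrite sumnE big_map /Bsum -val_enum_ord big_map big_enum.
  rewrite /F indicE memNset ?mule0// => E; by rewrite -E eqxx in sw.
Qed.

(** The tree bound dominates the probabilities by a convergent geometric series. Off the null set of
    [ae_beta_le1], avoiding [tree_event] means that [Q] fails. *)
Lemma borel_cantelli_tree (n : nat -> nat) (Q : nat -> pred (seq nat)) (C q : R) :
  0 <= C -> 0 < q < 1 ->
  (forall k, tree_mean (n k) (fun s => (Q k s)%:R) <= C * q ^+ k) ->
  {ae P, forall w, exists k0, forall k, (k0 <= k)%N ->
    ~~ Q k (mkseq (fun i => beta i w) (n k))}.
Proof.
move=> C0 /andP[q0 q1] HQ.
pose F k := tree_event (n k) (Q k).
have mF k : measurable (F k) by exact: measurable_tree_event.
have P0 : P (lim_sup_set F) = 0%E.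
  apply: lim_sup_set_cvg0 => //.
  apply: (@le_lt_trans _ _ (\sum_(k <oo) (geometric C q k)%:E)%E).
    apply: lee_nneseries => [k _ _|k _]; first exact: measure_ge0.
    by apply: le_trans (probability_tree_event _ _) _; rewrite lee_fin HQ.
  have q1' : `|q| < 1 by rewrite ger0_norm// ltW.
  rewrite (_ : (fun n => _)%E = EFin \o series (geometric C q)); last first.
    by apply/funext => k /=; rewrite sumEFin.
  by rewrite EFin_lim ?ltry//; exact: is_cvg_geometric_series.
have : P.-negligible (lim_sup_set F).
  apply/negligibleP => //.
  apply: bigcapT_measurable => k; exact: bigcup_measurable.
move=> H; have : {ae P, forall w, ~ lim_sup_set F w}.
  by apply: negligibleS H => w /= /contrapT.
apply: filterS2 ae_beta_le1 => w w1 wF.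
have [k0 Hk0] : exists k0, forall k, (k0 <= k)%N -> ~ F k w.
  apply: contrapT => H0; apply: wF => k _; apply: contrapT => Hk.
  by apply: H0; exists k => j kj Fj; apply: Hk; exists j.
exists k0 => k kk0; apply/negP => Qk.
by apply: (Hk0 k kk0); exact: mem_tree_event.
Qed.

End BernoulliSequence.

(** * Truncated divisor sums along the walk *)

Section TruncatedDivisorSums.
Context {R : realFieldType} (D : pred nat) (D0 : D 0%N = false).
Context (K : nat -> nat) (K_mono : {homo K : m n / (m <= n)%N}).

Let y (n b : nat) : R := divisor_deviation D (K n) b.

(** On a bit 0 the deviation cancels against the martingale increment [- y], and the corrector is
    unchanged. On a bit 1 they add up to [2 y], which is the corrector's increment. *)
Lemma path_deviation_le (x : nat -> nat) N : (forall i, (x i <= 1)%N) ->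
  `|\sum_(0 <= n < N.+1) y n (\sum_(i < n) x i) + martingale y x N.+1|
  <= (K N)%:R *+ 2.
Proof.
move=> x1; pose B n := (\sum_(i < n) x i)%N.
rewrite /martingale -big_split/=.
have -> : \sum_(0 <= n < N.+1)
    (y n (\sum_(i < n) x i) + ((x n)%:R *+ 2 - 1) * y n (\sum_(i < n) x i)) =
    \sum_(0 <= n < N.+1) (corrector D (K n) (B n.+1) - corrector D (K n) (B n)).
  apply: eq_bigr => n _; rewrite /B big_ord_recr/=.
  have := x1 n; case: (x n) => [|[|//]] _.
    by rewrite addn0 subrr mul0rn sub0r mulN1r subrr.
  by rewrite addn1 correctorS// /y; ring.
apply: (abel_telescope K (fun n => corrector D (K n) (B n))
  (fun n => corrector D (K n) (B n.+1))) => n; try exact: corrector_bounds.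
by apply: corrector_mono => //; exact: K_mono.
Qed.

(** Averaging over the next bit, the corrector gains half of [2 y], so the mean deviation telescopes
    with no martingale part. *)
Lemma mean_deviation_le N :
  `|\sum_(0 <= n < N.+1) walk_mean n (y n)| <= (K N)%:R *+ 2.
Proof.
have -> : \sum_(0 <= n < N.+1) walk_mean n (y n) =
    \sum_(0 <= n < N.+1) (walk_mean n.+1 (corrector D (K n)) -
                          walk_mean n (corrector D (K n))).
  apply: eq_bigr => n _; rewrite walk_meanS -tree_meanB; congr tree_mean.
  by apply/funext => s; rewrite correctorS// /y; field.
have bounds m n : 0 <= walk_mean m (corrector D (K n) : nat -> R) <= (K n)%:R *+ 2.
  rewrite -[X in X <= _ <= _](tree_mean_cst m) -[X in _ <= _ <= X](tree_mean_cst m).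
  by apply/andP; split; apply: tree_mean_le => s;
    have /andP[] := @corrector_bounds R D D0 (K n) (sumn s).
apply: (abel_telescope K (fun n => walk_mean n (corrector D (K n)))
  (fun n => walk_mean n.+1 (corrector D (K n)))) => n; try exact: bounds.
have mono b := @corrector_mono R D D0 (K n) (K n.+1) b (K_mono _ _ (leqnSn n)).
apply/andP; split; first by apply: tree_mean_le => s; have /andP[] := mono (sumn s).
rewrite -lerBlDl -tree_meanB -[leRHS](tree_mean_cst n.+1).
apply: tree_mean_le => s.
by have /andP[_] := mono (sumn s); rewrite lerBlDl.
Qed.

(** The cutoff at [2 ^ k] dominates all earlier ones and gives a bound per site that is free of
    time. The 6 is 2 from the occupation of a site times 3 from [sum_divisor_moment_le]. *)
Lemma reaches_mean_le (k : nat) (c : R) : 0 <= c ->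
  (forall n, K n ^ 2 <= n)%N ->
  tree_mean (2 ^ k) (fun s => (reaches y c 0 0 0 s)%:R) * c ^+ 2
  <= 6%:R * k.+1%:R ^+ 3 * (2 ^ k)%:R.
Proof.
move=> c0 Ksqr; apply: le_trans (maximal_inequality y c (2 ^ k) 0 0 0 c0) _.
rewrite expr0n add0r.
apply: le_trans (quadratic_variation_le y
  (fun j => divisor_count (K (2 ^ k)) j ^+ 2 + harmonic_sum (K (2 ^ k)) ^+ 2)
  (2 ^ k) 0 0 _) _.
  by move=> i j ik; apply: divisor_deviation_sqr => //; apply: K_mono; lia.
have := sum_divisor_moment_le (R := R) (K (2 ^ k)) k (Ksqr _).
by rewrite add0n; lra.
Qed.

(** From time [n0] on, the modulus [k0] alone contributes [1 / k0]. *)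
Lemma density_ge (k0 n0 N : nat) : (0 < k0)%N -> D k0 ->
  (forall n, (n0 <= n)%N -> (k0 <= K n)%N) ->
  (N%:R - n0%:R) / k0%:R <= \sum_(1 <= n < N.+1) density D (K n) :> R.
Proof.
move=> k00 Dk0 Kn0; elim: N => [|N IHN].
  by rewrite big_geq// sub0r pmulr_lle0 ?invr_gt0 ?ltr0n// oppr_le0.
have dge0 n : 0 <= density D (K n) :> R.
  by apply: sumr_ge0 => i _; rewrite invr_ge0.
have [n0N|Nn0] := leqP n0 N.+1; last first.
  apply: (@le_trans _ _ 0); last exact: sumr_ge0.
  by rewrite pmulr_lle0 ?invr_gt0 ?ltr0n// subr_le0 ler_nat ltnW.
rewrite big_nat_recr//= -natr1 addrAC mulrDl mul1r lerD//.
rewrite /density big_mkcond (bigD1_seq k0) ?iota_uniq//=; last first.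
  by rewrite mem_index_iota/= ltnS Kn0.
by rewrite Dk0 lerDl; apply: sumr_ge0 => i _; case: ifP; rewrite ?invr_ge0.
Qed.

End TruncatedDivisorSums.

Lemma cube_le_geometric (R : realFieldType) (r : R) : 1 < r ->
  exists2 C, 0 <= C & forall k, k.+1%:R ^+ 3 <= C * r ^+ k.
Proof.
(* The 7 comes from [(1 + t) ^ 3 <= 1 + 7 t], valid for [0 <= t <= 1]. *)
move=> r1; pose t := Num.min 1 ((r - 1) / 7%:R).
have t0 : 0 < t by rewrite lt_min ltr01 divr_gt0 ?subr_gt0 ?ltr0n.
have t1 : t <= 1 by rewrite ge_min lexx.
have tr : t <= (r - 1) / 7%:R by rewrite ge_min lexx orbT.
have bernoulli k : k.+1%:R * t <= (1 + t) ^+ k.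
  elim: k => [|k IHk]; first by rewrite expr0 mul1r.
  have ge1 : 1 <= (1 + t) ^+ k by rewrite exprn_ege1// lerDl ltW.
  rewrite exprS -natr1; nra.
have cube : (1 + t) ^+ 3 <= r by nra.
exists (t^-1 ^+ 3) => [|k]; first by rewrite exprn_ge0// invr_ge0 ltW.
apply: (@le_trans _ _ ((t^-1 * (1 + t) ^+ k) ^+ 3)).
  rewrite lerXn2r ?nnegrE// ?mulr_ge0 ?invr_ge0 ?exprn_ge0 ?addr_ge0 ?(ltW t0)//.
  by rewrite mulrC ler_pdivlMr.
rewrite exprMn ler_wpM2l ?exprn_ge0 ?invr_ge0 ?(ltW t0)//.
have r0 : 0 <= r by exact: ltW (lt_trans ltr01 r1).
by rewrite exprAC lerXn2r ?nnegrE ?exprn_ge0 ?addr_ge0 ?(ltW t0).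
Qed.

(** * The cutoff at [n ^ theta] *)

Section DivisorCutoff.
Context {R : realType} (theta : R) (theta_gt0 : 0 < theta).

Definition cutoff (n : nat) : nat := Num.truncn (n%:R `^ theta).

Lemma cutoff0 : cutoff 0 = 0%N.
Proof. by rewrite /cutoff powR0 ?gt_eqF// truncn0. Qed.

Lemma cutoff_mono : {homo cutoff : m n / (m <= n)%N}.
Proof.
move=> m n mn; apply: le_truncn.
by apply: ge0_ler_powR; rewrite ?nnegrE ?(ltW theta_gt0)// ler_nat.
Qed.

Lemma cutoff_sqr n : theta <= 2^-1 -> (cutoff n ^ 2 <= n)%N.
Proof.
move=> th; case: n => [|n]; first by rewrite cutoff0.
rewrite -(ler_nat R) natrX; apply: (@le_trans _ _ ((n.+1%:R `^ theta) ^+ 2)).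
  by rewrite lerXn2r ?nnegrE ?powR_ge0// truncn_le ?powR_ge0.
rewrite -powR_mulrn ?powR_ge0// -powRrM -[leRHS]powRr1//.
by apply: ler_powR; rewrite ?ler1n//; lra.
Qed.

Lemma cutoff_unbounded k : exists n0, forall n, (n0 <= n)%N -> (k <= cutoff n)%N.
Proof.
exists (Num.truncn (k%:R `^ theta^-1 : R)).+1 => n kn.
rewrite /cutoff truncn_ge_nat ?powR_ge0//.
have kn' : k%:R `^ theta^-1 <= n%:R :> R.
  apply: ltW; apply: lt_le_trans (truncnS_gt _) _.
  by rewrite ler_nat.
have -> : k%:R = (k%:R `^ theta^-1) `^ theta :> R.
  by rewrite -powRrM mulVf ?gt_eqF// powRr1.
by apply: ge0_ler_powR; rewrite ?nnegrE ?powR_ge0 ?(ltW theta_gt0).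
Qed.

Lemma div_countE (D : set nat) n b :
  (div_count theta D n b)%:R =
  divisor_deviation [pred k | k \in D] (cutoff n) b +
  density [pred k | k \in D] (cutoff n) :> R.
Proof.
rewrite /div_count natr_sum /divisor_deviation /density -big_split/=.
by apply: eq_bigr => k _; rewrite subrK.
Qed.

End DivisorCutoff.

(** * Almost sure asymptotics *)

Lemma powR_half_sqr (R : realType) (a : R) : 0 <= a -> (a `^ 2^-1) ^+ 2 = a.
Proof. by move=> a0; rewrite powR12_sqrt// sqr_sqrtr. Qed.

Lemma ae_martingale_lt d (T : measurableType d) (R : realType)
    (P : probability T R) (beta : nat -> {RV P >-> nat})
    (D : pred nat) (K : nat -> nat) (eps : R) :
  (forall i, fair_bernoulli (beta i)) -> mutually_independent beta ->
  D 0%N = false -> {homo K : m n / (m <= n)%N} -> (forall n, K n ^ 2 <= n)%N ->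
  0 < eps ->
  {ae P, forall w, exists k0, forall k, (k0 <= k)%N -> forall N, (N <= 2 ^ k)%N ->
    `|martingale (fun n => divisor_deviation D (K n)) (fun i => beta i w) N|
    < (2 ^ k)%:R `^ (2^-1 + eps)}.
Proof.
move=> bern indep D0 K_mono Ksqr eps0.
pose y n b : R := divisor_deviation D (K n) b.
pose c k : R := (2 ^ k)%:R `^ (2^-1 + eps).
pose r : R := 2 `^ eps.
have r1 : 1 < r.
  have -> : 1 = 1 `^ eps by rewrite powR1.
  by apply: gt0_ltr_powR; rewrite ?nnegrE ?ltr1n.
have r0 : 0 < r by exact: lt_trans r1.
have p2 k : 0 < (2 ^ k)%:R :> R by rewrite ltr0n expn_gt0.
have c2 k : c k ^+ 2 = (2 ^ k)%:R * (r ^+ k * r ^+ k).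
  have -> : c k = (2 ^ k)%:R `^ 2^-1 * r ^+ k.
    rewrite /c powRD ?(gt_eqF (p2 k)) ?implybT//; congr (_ * _).
    have -> : (2 ^ k)%:R = 2 `^ k%:R :> R by rewrite powR_mulrn// natrX.
    have -> : r ^+ k = r `^ k%:R by rewrite powR_mulrn// ltW.
    exact: powRAC.
  by rewrite exprMn powR_half_sqr ?(ltW (p2 k))// expr2.
(* The maximal inequality bounds the probability by [6 (k + 1) ^ 3 / r ^ (2 k)]. One factor [r ^ k]
   absorbs the cube, the other gives the geometric decay. *)
have [C C0 HC] := cube_le_geometric R r r1.
have HQ k : tree_mean (2 ^ k) (fun s => (reaches y (c k) 0 0 0 s)%:R)
    <= 6%:R * C * r^-1 ^+ k.
  have rk : 0 < r ^+ k by exact: exprn_gt0.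
  have := reaches_mean_le D D0 K K_mono k (c k) (powR_ge0 _ _) Ksqr.
  rewrite c2 -/y; set tm := tree_mean _ _ => H.
  rewrite exprVn ler_pdivlMr// -(ler_pM2r rk) -(ler_pM2r (p2 k)).
  apply: le_trans (_ : 6%:R * k.+1%:R ^+ 3 * (2 ^ k)%:R <= _); last first.
    by rewrite ler_pM2r// -[leRHS]mulrA ler_pM2l ?ltr0n.
  by apply: le_trans H; rewrite le_eqVlt; apply/orP; left; apply/eqP; ring.
have q01 : 0 < r^-1 < 1 by rewrite invr_gt0 r0 invf_lt1.
have := borel_cantelli_tree P beta bern indep (fun k => 2 ^ k)%N
  (fun k => reaches y (c k) 0 0 0) (6%:R * C) r^-1 _ q01 HQ.
move=> /(_ (mulr_ge0 (ler0n _ _) C0)); apply: filterS => w [k0 Hk0].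
exists k0 => k kk0 N Nk; rewrite ltNge; apply: contra (Hk0 k kk0).
exact: martingale_reaches.
Qed.

Theorem theorem1p1 (d : measure_display) (T : measurableType d) (R : realType)
    (P : probability T R) (beta : nat -> {RV P >-> nat})
    (beta_bernoulli : forall i, fair_bernoulli (beta i))
    (beta_indep : mutually_independent beta)
    (D : set nat) (D_pos : forall k, D k -> (0 < k)%N)
    (theta : R) (theta_gt0 : 0 < theta) (theta_lt : theta < 6^-1)
    (eps : R) (eps_gt0 : 0 < eps) :
  {ae P, forall w : T,
    (fun N : nat =>
       \sum_(1 <= n < N.+1) (div_count theta D n (Bsum beta n w))%:R)
    = mean_div_sum beta theta D
      +O_\oo (fun N : nat => mean_div_sum beta theta D N `^ (2^-1 + eps))}.
Proof.
pose Db := [pred k | k \in D]; pose K := @cutoff R theta.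
pose y n b : R := divisor_deviation Db (K n) b.
pose A N : R := \sum_(1 <= n < N.+1) density Db (K n).
pose M N := mean_div_sum beta theta D N.
have D0 : Db 0%N = false by apply/negP => /set_mem /D_pos.
have K_mono : {homo K : m n / (m <= n)%N} by exact: cutoff_mono.
have Ksqr n : (K n ^ 2 <= n)%N by apply: cutoff_sqr => //; lra.
(* The telescoping sums start at [n = 0], those of the theorem at [n = 1]; the extra term
   vanishes. *)
have y0 b : y 0%N b = 0.
  by rewrite /y /K cutoff0// /divisor_deviation big_mkcond big_nat1 D0.
have KM N : `|M N - A N| <= (K N)%:R *+ 2.
  have -> : M N - A N = \sum_(0 <= n < N.+1) walk_mean n (y n).
    rewrite big_ltn// {1}/walk_mean/= y0 add0r /M /A /mean_div_sum -sumrB.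
    apply: eq_bigr => n _.
    rewrite expectation_Bsum//= -[X in _ - X](tree_mean_cst n) -tree_meanB.
    congr tree_mean; apply/funext => s; by rewrite div_countE addrK.
  exact: mean_deviation_le.
pose S w N : R := \sum_(1 <= n < N.+1) (div_count theta D n (Bsum beta n w))%:R.
pose a : R := 2^-1 + eps.
have a0 : 0 < a by rewrite addr_gt0// invr_gt0.
(* For empty [D] the error scale is itself 0, so equality must be exact; otherwise a member [k0]
   forces linear growth of [M]. *)
have [[k0 Dk0]|Dempty] := pselect (exists k, D k); last first.
  have cnt0 n b : div_count theta D n b = 0%N.
    rewrite /div_count big_pred0// => k; apply/negbTE/negP => /set_mem Dk.
    by apply: Dempty; exists k.
  apply: aeW => w; apply/eqaddOP/bigO_exP; exists 1 => //; apply: nearW => N.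
  suff: `|S w N - M N| <= 1 * `|M N `^ a| by [].
  have -> : S w N = 0 by apply: big1 => n _; rewrite cnt0.
  have -> : M N = 0.
    apply: big1 => n _; rewrite expectation_Bsum//=.
    by under eq_fun do rewrite cnt0; exact: tree_mean_cst.
  by rewrite subrr normr0 mul1r.
have k0_gt0 : (0 < k0)%N by exact: D_pos.
have [n0 Kn0] := cutoff_unbounded theta theta_gt0 k0.
(* [4 n0 <= N] gives [A N >= 3 N / (4 k0)]. With [K N ^ 2 <= N], the term [64 k0 ^ 2] gives
   [8 k0 K N <= N], so the error [2 K N] is at most [N / (4 k0)], leaving [M N >= N / (2 k0)]. *)
pose N1 := (4 * n0 + 64 * k0 ^ 2 + 1)%N.
have M_ge N : (N1 <= N)%N -> N%:R <= 2 * k0%:R * M N.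
  move=> N1N; have H1 : (N%:R - n0%:R) / k0%:R <= A N.
    by apply: density_ge => //; rewrite /Db /= mem_set.
  have := KM N; rewrite ler_distl => /andP[H2 _].
  have H3 : (8 * k0 * K N <= N)%N.
    have := Ksqr N; rewrite /N1 in N1N.
    by have [?|?] := leqP (K N) (8 * k0); nia.
  have H4 : (4 * n0 <= N)%N by rewrite /N1 in N1N; lia.
  move: H3 H4; rewrite -!(ler_nat R) !natrM => H3 H4.
  have k0R : 0 < k0%:R :> R by rewrite ltr0n.
  rewrite ler_pdivrMr// in H1.
  have := ler_wpM2l (ltW k0R) H2; lra.
apply: filterS2 (ae_beta_le1 P beta beta_bernoulli)
  (@ae_martingale_lt _ _ _ P beta Db K eps beta_bernoulli beta_indep
    D0 K_mono Ksqr eps_gt0) => w w1 [j0 Hj0].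
have SA N : `|S w N - A N + martingale y (fun i => beta i w) N.+1| <= (K N)%:R *+ 2.
  have -> : S w N - A N = \sum_(0 <= n < N.+1) y n (\sum_(i < n) beta i w).
    rewrite big_ltn// y0 add0r /S /A -sumrB.
    by apply: eq_bigr => n _; rewrite div_countE addrK.
  exact: path_deviation_le.
apply/eqaddOP/bigO_exP.
(* [4 ^ a] comes from the martingale, 4 from two telescoping errors [2 K N] with [K N <= N ^ a], and
   the last factor from replacing [N] by [2 k0 M N]. *)
exists ((4 `^ a + 4) * (2 * k0%:R) `^ a).
  by rewrite mulr_gt0 ?addr_gt0 ?powR_gt0 ?mulr_gt0 ?ltr0n.
near=> N.
have N1N : (N1 <= N)%N by near: N; exact: nbhs_infty_ge.
have j0N : (2 ^ j0 <= N)%N by near: N; exact: nbhs_infty_ge.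
have N_gt0 : (0 < N)%N by rewrite /N1 in N1N; lia.
have M0 : 0 <= M N.
  by apply: sumr_ge0 => n _; rewrite fine_ge0// expectation_ge0.
have KN : (K N)%:R <= N%:R `^ a.
  rewrite (@le_trans _ _ (N%:R `^ 2^-1))//; last first.
    by rewrite ler_powR ?ler1n// lerDl ltW.
  by rewrite -(@ler_pXn2r _ 2) ?nnegrE ?powR_ge0// powR_half_sqr// -natrX ler_nat.
(* The dyadic scale just above the martingale's index [N + 1], so [2 ^ k <= 2 (N + 1) <= 4 N]. *)
pose k := (trunc_log 2 N.+1).+1.
have WN : `|martingale y (fun i => beta i w) N.+1| <= 4 `^ a * N%:R `^ a.
  have /andP[kN Nk] : (2 ^ k.-1 <= N.+1 < 2 ^ k)%N.
    exact: trunc_log_bounds.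
  have j0k : (j0 <= k)%N.
    by rewrite -(leq_exp2l (m := 2))// (leq_trans j0N)// ltnW// ltnW.
  apply: le_trans (ltW (Hj0 k j0k N.+1 (ltnW Nk))) _.
  rewrite -powRM//; apply: ge0_ler_powR; rewrite ?nnegrE ?(ltW a0)//.
  rewrite -natrM ler_nat; by move: kN; rewrite /k expnS /=; lia.
have SM : `|S w N - M N| <= (4 `^ a + 4) * N%:R `^ a.
  have := SA N; have := KM N; move: WN KN; by rewrite !ler_norml; lra.
suff: `|S w N - M N| <= (4 `^ a + 4) * (2 * k0%:R) `^ a * `|M N `^ a| by [].
apply: le_trans SM _; rewrite (ger0_norm (powR_ge0 _ _)).
rewrite -mulrA ler_wpM2l// ?addr_ge0 ?powR_ge0//.
rewrite -powRM ?mulr_ge0//; apply: ge0_ler_powR; rewrite ?nnegrE ?(ltW a0) ?mulr_ge0//.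
exact: M_ge.
Unshelve. all: by end_near.
Qed.
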